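(* Consider the fully-random corruption model with corruption probability $p$. If $p \ge 1/2$, then the probability that Problem (P) recovers the ground truth is at most $1/2$. Furthermore, if $r_{\bar x}, r_{\bar y}, r_{\bar z}, p$ are positive constants (independent of $n,m,l$) and $p > 1/2$, then with high probability Problem (P) does not recover the ground truth.
   Context: Write $[n]=\{1,\dots,n\}$. For vectors $x\in\mathbb R^n,y\in\mathbb R^m,z\in\mathbb R^l$, $x\otimes y\otimes z$ is the $n\times m\times l$ tensor with $(i,j,k)$ entry $x_iy_jz_k$; $\|\cdot\|$ is the Frobenius norm. Fully-random corruption model: fix $\bar x\in\{0,1\}^n$, $\bar y\in\{0,1\}^m$, $\bar z\in\{0,1\}^l$; the ground truth is $\bar{\mathcal W}=\bar x\otimes\bar y\otimes\bar z$. Given $p\in[0,1]$, the random noisy binary tensor $\mathcal G=(g_{ijk})$ is obtained by corrupting each entry independently: $g_{ijk}=1-\bar x_i\bar y_j\bar z_k$ with probability $p$ and $g_{ijk}=\bar x_i\bar y_j\bar z_k$ with probability $1-p$. $r_{\bar x}$ (resp. $r_{\bar y}$, $r_{\bar z}$) is the ratio of the number of ones in $\bar x$ (resp. $\bar y$, $\bar z$) to its number of entries. Problem (P), with input $\mathcal G$: minimize $\|\mathcal G-x\otimes y\otimes z\|^2$ over $x\in\{0,1\}^n$, $y\in\{0,1\}^m$, $z\in\{0,1\}^l$. Problem (P) recovers the ground truth if it has a unique optimal solution and this solution is $(\bar x,\bar y,\bar z)$. ''With high probability'' means with probability tending to $1$ as $n,m,l\to\infty$ (along a family of instances whose three dimensions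 all go to infinity). *)

(* Defs.v *)
From HB Require Import structures.
From mathcomp Require Import all_boot all_order all_algebra.
From mathcomp Require Import all_classical all_reals all_analysis.
Set Implicit Arguments.
Unset Strict Implicit.
Unset Printing Implicit Defensive.
Import Order.TTheory GRing.Theory Num.Theory.
Import numFieldNormedType.Exports.
Local Open Scope classical_set_scope.
Local Open Scope ring_scope.

Definition tensor (R : Type) (n m l : nat) := 'I_n -> 'I_m -> 'I_l -> R.

Definition outer (R : realType) n m l
    (x : 'rV[R]_n) (y : 'rV[R]_m) (z : 'rV[R]_l) : tensor R n m l :=
  fun i j k => x ord0 i * y ord0 j * z ord0 k.

Definition frobenius (R : realType) n m l (A : tensor R n m l) : R :=
  Num.sqrt (\sum_(i < n) \sum_(j < m) \sum_(k < l) A i j k ^+ 2).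

(* {0,1}^n; [bvecR] is its inclusion in R^n. *)
Definition bvec (n : nat) := {ffun 'I_n -> bool}.

Definition bvecR (R : realType) n (x : bvec n) : 'rV[R]_n :=
  \row_(i < n) (x i)%:R.

Definition ones_ratio (R : realType) n (x : bvec n) : R :=
  #|[set i | x i]%SET|%:R / n%:R.

Definition objective (R : realType) n m l (A : tensor R n m l)
    (x : bvec n) (y : bvec m) (z : bvec l) : R :=
  frobenius (fun i j k =>
    A i j k - outer (bvecR R x) (bvecR R y) (bvecR R z) i j k) ^+ 2.

Definition optimal (R : realType) n m l (A : tensor R n m l)
    (x : bvec n) (y : bvec m) (z : bvec l) : Prop :=
  forall (x' : bvec n) (y' : bvec m) (z' : bvec l),
    objective A x y z <= objective A x' y' z'.

Definition recovers (R : realType) n m l (A : tensor R n m l)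
    (xb : bvec n) (yb : bvec m) (zb : bvec l) : Prop :=
  optimal A xb yb zb /\
  forall (x : bvec n) (y : bvec m) (z : bvec l),
    optimal A x y z -> [/\ x = xb, y = yb & z = zb].

Definition mutually_independent d (T : measurableType d) (R : realType)
    (P : probability T R) d' (T' : measurableType d') (I : finType)
    (X : I -> {RV P >-> T'}) : Prop :=
  forall (J : {set I}) (B : I -> set T'),
    (forall i, i \in J -> measurable (B i)) ->
    P (\bigcap_(i in [set` J]) (X i @^-1` B i)) =
    (\prod_(i in J) P (X i @^-1` B i))%E.

Definition random_btensor d (T : measurableType d) (R : realType)
    (P : probability T R) (n m l : nat) := tensor {RV P >-> bool} n m l.

Definition realization d (T : measurableType d) (R : realType)
    (P : probability T R) n m l (G : random_btensor P n m l) (w : T) :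
    tensor R n m l :=
  fun i j k => (G i j k w)%:R.

Definition fully_random d (T : measurableType d) (R : realType)
    (P : probability T R) n m l (xb : bvec n) (yb : bvec m) (zb : bvec l)
    (p : R) (G : random_btensor P n m l) : Prop :=
  let W := outer (bvecR R xb) (bvecR R yb) (bvecR R zb) in
  mutually_independent (fun s : 'I_n * 'I_m * 'I_l => G s.1.1 s.1.2 s.2) /\
  forall (i : 'I_n) (j : 'I_m) (k : 'I_l),
    P [set w | realization G w i j k = 1 - W i j k] = p%:E /\
    P [set w | realization G w i j k = W i j k] = (1 - p)%:E.

(* Main.v *)
Require Import Defs.
From HB Require Import structures.
From mathcomp Require Import all_boot all_order all_algebra.
From mathcomp Require Import all_classical all_reals all_analysis.
From mathcomp Require Import ring lra.
Import Order.TTheory GRing.Theory Num.Theory.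
Import numFieldNormedType.Exports.
Local Open Scope classical_set_scope.
Local Open Scope ring_scope.

Set Implicit Arguments.
Unset Strict Implicit.
Unset Printing Implicit Defensive.

(** Let [D] be the support of the ground truth.  On binary data the objective
    is a Hamming distance, so replacing [x] by the zero vector changes it by
    the number of ones of the data in [D] minus the number of zeros in [D].
    Unless the ones are a strict majority in [D], the triple [(0, y', z)] is
    therefore optimal for every [y'], which contradicts uniqueness; this
    includes the case of an empty [D] ([recovers_one_majority]).

    An entry of [D] is one with probability [q = 1 - p] and zero with
    probability [p >= q], so a majority of ones is an unlikely event.

    - Complementing the pattern of ones inside [D] sends a pattern with a
      majority of ones, of weight [q ^+ a * p ^+ b] with [b < a], to the
      pattern of weight [q ^+ b * p ^+ a], at least as large, which has a
      majority of zeros.  A majority of ones is thus at most as likely as the disjoint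
      event of a majority of zeros, hence has probability at most [1 / 2]
      ([one_majority_prob_half]).

    - Each of the at most [2 ^ #|D|] patterns with a majority of ones has
      weight at most [Num.sqrt (q * p) ^+ #|D|], so the event has probability
      at most [(2 * Num.sqrt (q * p)) ^+ #|D|] ([one_majority_prob_exp]).
      When [p > 1 / 2] the base is less than [1], and [#|D|] tends to infinity
      because the ratios of ones are positive constants
      ([support_card_cvgny]). *)

(** * Majorities of independent biased bits *)

Section BernoulliPatterns.
Context {d : measure_display} {T : measurableType d} {R : realType}.
Context {P : probability T R} {I : finType}.
Variables (X : I -> {RV P >-> bool}) (S : {set I}).

Definition ones_in (w : T) : {set I} := [set i in S | X i w]%SET.

Lemma ones_in_eqE (A : {set I}) : A \subset S ->
  [set w | ones_in w = A] =
  \bigcap_(i in [set` S]) (X i @^-1` [set (i \in A)]).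
Proof.
move=> AS; apply/seteqP; split=> [w /= <- i /= iS | w /= XA].
  by rewrite inE iS.
apply/setP => i; rewrite inE; case: (boolP (i \in S)) => [/XA <- //|iS].
by apply/esym/negbTE; apply: contra iS; exact: (fintype.subsetP AS).
Qed.

Lemma measurable_ones_in_eq (A : {set I}) : measurable [set w | ones_in w = A].
Proof.
case: (boolP (A \subset S)) => [AS|AS].
  rewrite ones_in_eqE //; apply: fin_bigcap_measurable => // i _.
  exact: measurable_funPTI.
rewrite (_ : [set _ | _] = set0) //; apply/seteqP; split=> // w /= wA.
by case/negP: AS; rewrite -wA; apply/fintype.subsetP => i; rewrite inE => /andP[].
Qed.

Lemma ones_in_bigcup (Q : set {set I}) :
  [set w | Q (ones_in w)] = \bigcup_(A in Q) [set w | ones_in w = A].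
Proof.
apply/seteqP; split=> [w Qw | w [A QA /= wA]]; last by rewrite wA.
by exists (ones_in w).
Qed.

(** The random set [ones_in] takes finitely many values, so every property of
    it is an event, whether or not that property is decidable. *)
Lemma measurable_ones_in (Q : set {set I}) : measurable [set w | Q (ones_in w)].
Proof.
rewrite ones_in_bigcup; apply: fin_bigcup_measurable => // A _.
exact: measurable_ones_in_eq.
Qed.

Variables (p q : R).
Hypothesis indepX : mutually_independent X.
Hypothesis X1 : forall i, i \in S -> P (X i @^-1` [set true]) = q%:E.
Hypothesis X0 : forall i, i \in S -> P (X i @^-1` [set false]) = p%:E.

Definition pattern_weight (A : {set I}) : R := q ^+ #|A| * p ^+ #|S :\: A|.

Lemma probability_ones_in_eq (A : {set I}) : A \subset S ->
  P [set w | ones_in w = A] = (pattern_weight A)%:E.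
Proof.
move=> AS; rewrite ones_in_eqE // indepX //.
rewrite (eq_bigr (fun i => (if i \in A then q else p)%:E)); last first.
  by move=> i iS; case: (i \in A); rewrite ?X1 ?X0.
rewrite prodEFin (big_setID A) /= (finset.setIidPr AS); congr ((_ * _)%:E).
  by rewrite (eq_bigr (fun=> q)) ?prodr_const // => i ->.
rewrite (eq_bigr (fun=> p)) ?prodr_const // => i.
by rewrite inE => /andP[/negbTE ->].
Qed.

Lemma probability_ones_in (Q : pred {set I}) :
  P [set w | Q (ones_in w)] =
  (\sum_(A : {set I} | (A \subset S) && Q A) pattern_weight A)%:E.
Proof.
have -> : [set w | Q (ones_in w)] =
    \bigcup_(A in [set` [pred A : {set I} | (A \subset S) && Q A]])
      [set w | ones_in w = A].
  apply/seteqP; split=> [w /= Qw|w [A /= /andP[_ QA] -> ]] //.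
  exists (ones_in w) => //; apply/andP; split=> //.
  by apply/fintype.subsetP => i; rewrite inE => /andP[].
rewrite content_fin_bigcup //; last first.
- by apply: fin_bigcup_measurable => // A _; exact: measurable_ones_in_eq.
- by move=> A _; exact: measurable_ones_in_eq.
- by move=> A B _ _ [w [/= <- <-]].
rewrite -(@bigfs _ _ _ _ (index_enum {set I})) ?index_enum_uniq //; last first.
  by move=> A _; rewrite mem_index_enum.
by rewrite -sumEFin; apply: eq_bigr => A /andP[AS _]; exact: probability_ones_in_eq.
Qed.

Definition one_majority (A : {set I}) : bool := (#|S :\: A| < #|A|)%N.

Hypothesis q0 : 0 <= q.
Hypothesis qp : q <= p.

(** Reflection: [A |-> S :\: A] exchanges the majorities of ones and of zeros,
    and a pattern with a majority of ones gains weight because [q <= p]. *)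
Lemma one_majority_prob_half :
  (P [set w | one_majority (ones_in w)] <= (1 / 2)%:E)%E.
Proof.
have p0 : 0 <= p by exact: le_trans qp.
pose zero_majority (A : {set I}) := (#|A| < #|S :\: A|)%N.
have leM : (P [set w | one_majority (ones_in w)] <=
            P [set w | zero_majority (ones_in w)])%E.
  rewrite !probability_ones_in lee_fin.
  rewrite [leRHS](reindex_onto (fun A => S :\: A) (fun A => S :\: A)); last first.
    by move=> A /andP[AS _]; rewrite finset.setDDr finset.setDv finset.set0U (finset.setIidPr AS).
  have DDid (A : {set I}) : A \subset S -> S :\: (S :\: A) = A.
    by move=> AS; rewrite finset.setDDr finset.setDv finset.set0U (finset.setIidPr AS).
  have -> : \sum_(A | ((S :\: A \subset S) && zero_majority (S :\: A)) &&
                (S :\: (S :\: A) == A)) pattern_weight (S :\: A) =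
            \sum_(A : {set I} | (A \subset S) && one_majority A)
               pattern_weight (S :\: A).
    apply: eq_bigl => A; rewrite /zero_majority /one_majority finset.subsetDl /=.
    case: (boolP (A \subset S)) => [AS|AS] /=; first by rewrite DDid // eqxx andbT.
    apply/negbTE/negP => /andP[_ /eqP DA]; case/negP: AS.
    by rewrite -DA finset.subsetDl.
  apply: ler_sum => A /andP[AS maj]; rewrite /pattern_weight DDid //.
  rewrite -(subnKC (ltnW maj)); set b := #|S :\: A|; set k := (#|A| - b)%N.
  rewrite !exprD -!mulrA ler_wpM2l ?exprn_ge0 // mulrC.
  by rewrite ler_wpM2l ?exprn_ge0 // lerXn2r // nnegrE.
have disj : [set w | one_majority (ones_in w)] `&`
            [set w | zero_majority (ones_in w)] = set0.
  apply/seteqP; split=> // w [/=]; rewrite /one_majority /zero_majority => a b.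
  by have := ltn_trans a b; rewrite ltnn.
have le1 : (P [set w | one_majority (ones_in w)] +
            P [set w | zero_majority (ones_in w)] <= 1)%E.
  have mM := measurable_ones_in one_majority.
  have mM' := measurable_ones_in zero_majority.
  have <- := measureU P mM mM' disj.
  exact/probability_le1/measurableU.
move: leM le1; rewrite !probability_ones_in -EFinD !lee_fin; lra.
Qed.

(** Union bound over the patterns: when [b <= a] and [q <= p],
    [q ^+ a * p ^+ b = q ^+ (a - b) * (q * p) ^+ b] and
    [q <= Num.sqrt (q * p)]. *)
Lemma one_majority_prob_exp :
  (P [set w | one_majority (ones_in w)] <= ((2 * Num.sqrt (q * p)) ^+ #|S|)%:E)%E.
Proof.
have p0 : 0 <= p by exact: le_trans qp.
set s := Num.sqrt (q * p).
have s0 : 0 <= s by exact: sqrtr_ge0.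
have s2 : s * s = q * p by rewrite -expr2 sqr_sqrtr // mulr_ge0.
have qs : q <= s.
  by rewrite -[leLHS](ger0_norm q0) -sqrtr_sqr ler_wsqrtr // expr2 ler_wpM2l.
rewrite probability_ones_in lee_fin.
apply: (@le_trans _ _ (\sum_(A in powerset S) s ^+ #|S|)); last first.
  by rewrite sumr_const card_powerset exprMn -[leLHS]mulr_natl natrX.
under [leRHS]eq_bigl do rewrite inE.
rewrite [leLHS]big_mkcondr; apply: ler_sum => A AS.
case: ifPn => [maj|_]; last exact: exprn_ge0.
rewrite -(cardsID A S) (finset.setIidPr AS) /pattern_weight -(subnKC (ltnW maj)).
  set b := #|S :\: A|; set k := (#|A| - b)%N.
rewrite !exprD mulrAC [leRHS]mulrAC.
rewrite -!exprMn s2 ler_wpM2l ?exprn_ge0 ?mulr_ge0 //.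
by rewrite lerXn2r // nnegrE.
Qed.

End BernoulliPatterns.

(** * Recovery forces a majority of ones on the support *)

Definition support n m l (x : bvec n) (y : bvec m) (z : bvec l) :
    {set 'I_n * 'I_m * 'I_l} :=
  finset.setX (finset.setX [set i | x i]%SET [set j | y j]%SET) [set k | z k]%SET.

Definition set_tensor (R : realType) n m l (A : {set 'I_n * 'I_m * 'I_l}) :
    tensor R n m l :=
  fun i j k => ((i, j, k) \in A)%:R.

Lemma in_support n m l (x : bvec n) (y : bvec m) (z : bvec l) i j k :
  ((i, j, k) \in support x y z) = [&& x i, y j & z k].
Proof. by rewrite !inE /= andbA. Qed.

Lemma outer_bvecR (R : realType) n m l (x : bvec n) (y : bvec m) (z : bvec l) :
  outer (bvecR R x) (bvecR R y) (bvecR R z) = set_tensor R (support x y z).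
Proof.
apply/funext => i; apply/funext => j; apply/funext => k.
rewrite /outer /set_tensor !mxE in_support.
by case: (x i); case: (y j); case: (z k); rewrite ?(mul0r, mulr0, mulr1).
Qed.

(** The entries and the products [x i * y j * z k] are zero or one, so the
    squared distance counts the positions where they differ. *)
Lemma objective_set_tensor (R : realType) n m l (A : {set 'I_n * 'I_m * 'I_l})
    (x : bvec n) (y : bvec m) (z : bvec l) :
  objective (set_tensor R A) x y z =
  (#|A :\: support x y z| + #|support x y z :\: A|)%:R.
Proof.
rewrite /objective /frobenius outer_bvecR sqr_sqrtr; last first.
  by do 3 (apply: sumr_ge0 => ? _); exact: sqr_ge0.
rewrite pair_big pair_big /= natrD -!sum1_card !natr_sum.
rewrite [X in _ = X + _]big_mkcond [X in _ = _ + X]big_mkcond -big_split /=.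
apply: eq_bigr => -[[i j] k] _; rewrite /set_tensor !inE /=.
by case: (_ \in A); case: (x i); case: (y j); case: (z k) => /=; ring.
Qed.

(** The competitors are [(0, y', z)]: they all have the zero tensor as product,
    hence the same objective, and two choices of [y'] violate uniqueness as
    soon as this objective is optimal.  [0 < m] provides two such [y']. *)
Lemma recovers_one_majority (R : realType) n m l (A : {set 'I_n * 'I_m * 'I_l})
    (x : bvec n) (y : bvec m) (z : bvec l) : (0 < m)%N ->
  recovers (set_tensor R A) x y z ->
  one_majority (support x y z) (support x y z :&: A).
Proof.
move=> m0 [opt uniq_opt]; rewrite /one_majority ltnNge; apply/negP => minor.
pose x0 : bvec n := [ffun=> false].
have supp0 y' : support x0 y' z = finset.set0.
  by apply/setP => -[[i j] k]; rewrite in_support ffunE inE.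
have opt0 y' : optimal (set_tensor R A) x0 y' z.
  move=> x1 y1 z1; apply: le_trans (opt x1 y1 z1).
  rewrite !objective_set_tensor supp0 finset.setD0 finset.set0D cards0 addn0.
  rewrite ler_nat -(cardsID (support x y z) A) addnC leq_add2l.
  rewrite finset.setIC (leq_trans minor) //.
  by rewrite finset.setDIr finset.setDv finset.set0U.
(* [y] would be both the constant true and the constant false vector. *)
have [_ yT _] := uniq_opt _ _ _ (opt0 [ffun=> true]).
have [_ yF _] := uniq_opt _ _ _ (opt0 [ffun=> false]).
have := congr1 (fun f : bvec m => f (Ordinal m0)) (etrans yT (esym yF)).
by rewrite !ffunE.
Qed.

(** * Probability of recovery in the fully-random model *)

Section FullyRandom.
Context {d : measure_display} {T : measurableType d} {R : realType}.
Context {P : probability T R} {n m l : nat}.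
Variables (x : bvec n) (y : bvec m) (z : bvec l) (p : R).
Variable G : random_btensor P n m l.
Let X (s : 'I_n * 'I_m * 'I_l) : {RV P >-> bool} := G s.1.1 s.1.2 s.2.

Lemma realization_set_tensor w :
  realization G w = set_tensor R (ones_in X [set: _]%SET w).
Proof.
apply/funext => i; apply/funext => j; apply/funext => k.
by rewrite /realization /set_tensor !inE.
Qed.

(** Recovery depends on the outcome only through the finite set of positions
    where the data are one. *)
Lemma measurable_recovers :
  measurable [set w | recovers (realization G w) x y z].
Proof.
under eq_set => w do rewrite realization_set_tensor.
exact: (measurable_ones_in X [set: _]%SET (fun A => recovers (set_tensor R A) x y z)).
Qed.

Lemma recovers_prob_le : (0 < m)%N ->
  (P [set w | recovers (realization G w) x y z] <=
   P [set w | one_majority (support x y z) (ones_in X (support x y z) w)])%E.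
Proof.
move=> m0; apply: le_measure.
- by rewrite inE; exact: measurable_recovers.
- by rewrite inE; exact: (measurable_ones_in X _ (one_majority _)).
move=> w /=; rewrite realization_set_tensor => /recovers_one_majority - /(_ m0).
congr one_majority; apply/setP => s; by rewrite !inE.
Qed.

Hypothesis GP : fully_random x y z p G.

Lemma fully_random_one s : s \in support x y z ->
  P (X s @^-1` [set true]) = (1 - p)%:E.
Proof.
case: s => [[i j] k] sS; have [_ /(_ i j k)[_ <-]] := GP.
congr (P _); rewrite outer_bvecR /set_tensor sS /realization /=.
apply/seteqP; split=> w /=; rewrite /X /=; first by move=> ->.
by case: (G i j k w) => // /esym /eqP; rewrite oner_eq0.
Qed.

Lemma fully_random_zero s : s \in support x y z ->
  P (X s @^-1` [set false]) = p%:E.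
Proof.
case: s => [[i j] k] sS; have [_ /(_ i j k)[<- _]] := GP.
congr (P _); rewrite outer_bvecR /set_tensor sS /realization /= subrr.
apply/seteqP; split=> w /=; rewrite /X /=; first by move=> ->.
by case: (G i j k w) => // /eqP; rewrite oner_eq0.
Qed.

Hypothesis m0 : (0 < m)%N.
Hypothesis p1 : p <= 1.
Hypothesis qp : 1 - p <= p.

Lemma recovers_prob_half :
  (P [set w | recovers (realization G w) x y z] <= (1 / 2)%:E)%E.
Proof.
apply: le_trans (recovers_prob_le m0) _.
apply: (one_majority_prob_half (p := p) (q := 1 - p)).
- by case: GP.
- exact: fully_random_one.
- exact: fully_random_zero.
- by rewrite subr_ge0.
- exact: qp.
Qed.

Lemma recovers_prob_exp :
  (P [set w | recovers (realization G w) x y z] <=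
   ((2 * Num.sqrt ((1 - p) * p)) ^+ #|support x y z|)%:E)%E.
Proof.
apply: le_trans (recovers_prob_le m0) _.
apply: one_majority_prob_exp.
- by case: GP.
- exact: fully_random_one.
- exact: fully_random_zero.
- by rewrite subr_ge0.
- exact: qp.
Qed.

End FullyRandom.

(** * Growth of the support and the theorem *)

(** A positive ratio excludes dimension [0], where the ratio is [0 / 0 = 0]. *)
Lemma ones_ratio_card (R : realType) n (x : bvec n) (r : R) :
  ones_ratio R x = r -> 0 < r -> (#|[set i | x i]%SET|%:R = r * n%:R) /\ (0 < n)%N.
Proof.
rewrite /ones_ratio => <- r0; have [n0|n0] := posnP n.
  by move: r0; rewrite [n%:R](congr1 _ n0) invr0 mulr0 ltxx.
by split=> //; rewrite divfK // pnatr_eq0 -lt0n.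
Qed.

Lemma ones_ratio_card_gt0 (R : realType) n (x : bvec n) (r : R) :
  ones_ratio R x = r -> 0 < r -> (0 < #|[set i | x i]%SET|)%N.
Proof.
move=> xr r0; have [E n0] := ones_ratio_card xr r0.
by rewrite -(ltr0n R) E mulr_gt0 // ltr0n.
Qed.

(** The support is a product of three nonempty sets, the first of which has
    [rx * n t] elements; growth of one dimension is enough. *)
Lemma support_card_cvgny (R : realType) (rx ry rz : R) (n m l : nat -> nat)
    (x : forall t, bvec (n t)) (y : forall t, bvec (m t)) (z : forall t, bvec (l t)) :
  0 < rx -> 0 < ry -> 0 < rz -> n t @[t --> \oo] --> \oo ->
  (forall t, ones_ratio R (x t) = rx) ->
  (forall t, ones_ratio R (y t) = ry) ->
  (forall t, ones_ratio R (z t) = rz) ->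
  #|support (x t) (y t) (z t)| @[t --> \oo] --> \oo.
Proof.
move=> rx0 ry0 rz0 noo xr yr zr; apply/cvgnyPge => K.
have [M _ MK] := nbhs_infty_ger (K%:R / rx).
move/cvgnyPge: noo => /(_ M); apply: filterS => t Mn.
rewrite !cardsX -mulnA (@leq_trans #|[set i | x t i]%SET|) //; last first.
  rewrite leq_pmulr // muln_gt0.
  by rewrite (ones_ratio_card_gt0 (yr t)) // (ones_ratio_card_gt0 (zr t)).
have [E _] := ones_ratio_card (xr t) rx0.
by rewrite -(ler_nat R) E mulrC -ler_pdivrMr //; exact: MK.
Qed.

Theorem theorem1 (R : realType) (p : R) (hp : 0 <= p <= 1) :
  (1 / 2 <= p ->
   forall (n m l : nat), (0 < n)%N -> (0 < m)%N -> (0 < l)%N ->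
   forall (xb : bvec n) (yb : bvec m) (zb : bvec l)
     (d : measure_display) (T : measurableType d) (P : probability T R)
     (G : random_btensor P n m l),
   fully_random xb yb zb p G ->
   (P [set w | recovers (realization G w) xb yb zb] <= (1 / 2)%:E)%E) /\
  (1 / 2 < p ->
   forall (rx ry rz : R), 0 < rx -> 0 < ry -> 0 < rz ->
   forall (n m l : nat -> nat),
   n t @[t --> \oo] --> \oo -> m t @[t --> \oo] --> \oo ->
   l t @[t --> \oo] --> \oo ->
   forall (xb : forall t, bvec (n t)) (yb : forall t, bvec (m t))
     (zb : forall t, bvec (l t)),
   (forall t, ones_ratio R (xb t) = rx) ->
   (forall t, ones_ratio R (yb t) = ry) ->
   (forall t, ones_ratio R (zb t) = rz) ->
   forall (d : nat -> measure_display) (T : forall t, measurableType (d t))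
     (P : forall t, probability (T t) R)
     (G : forall t, random_btensor (P t) (n t) (m t) (l t)),
   (forall t, fully_random (xb t) (yb t) (zb t) p (G t)) ->
   P t [set w | ~ recovers (realization (G t) w) (xb t) (yb t) (zb t)]
     @[t --> \oo] --> (1%:E : \bar R)).
Proof.
have [_ p1] := andP hp.
split=> [p_half n m l _ m0 _ x y z d T P G GP|p_half rx ry rz rx0 ry0 rz0 n m l noo _ _
  x y z xr yr zr d T P G GP].
  by apply: (recovers_prob_half GP) => //; lra.
set c := 2 * Num.sqrt ((1 - p) * p).
have c1 : `|c| < 1.
  rewrite ger0_norm ?mulr_ge0 ?sqrtr_ge0 // /c mulrC -ltr_pdivlMr //.
  rewrite -[ltRHS]ger0_norm ?divr_ge0 // -sqrtr_sqr ltr_sqrt; nra.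
have Noo := support_card_cvgny rx0 ry0 rz0 noo xr yr zr.
have cN : c ^+ #|support (x t) (y t) (z t)| @[t --> \oo] --> 0.
  exact: (cvg_comp _ _ Noo (cvg_expr c1)).
(* Squeeze between [1 - c ^+ #|support|] and [1]. *)
have low : (1 - c ^+ #|support (x t) (y t) (z t)|)%:E @[t --> \oo] --> (1%:E : \bar R).
  apply: cvg_EFin; first by near=> t.
  rewrite -[X in _ --> X]subr0; apply: cvgB => //; exact: cvg_cst.
apply: (squeeze_cvge _ low (cvg_cst (1%:E : \bar R))).
near=> t; have mt0 : (0 < m t)%N by case: (ones_ratio_card (yr t) ry0).
have mrec := measurable_recovers (x t) (y t) (z t) (G t).
have -> : P t [set w | ~ recovers (realization (G t) w) (x t) (y t) (z t)] =
    (1 - P t [set w | recovers (realization (G t) w) (x t) (y t) (z t)])%E.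
  by rewrite -probability_setC.
apply/andP; split; last by rewrite -probability_setC // probability_le1 //; exact: measurableC.
by rewrite EFinB leeB // (recovers_prob_exp (GP t)) //; lra.
Unshelve. all: by end_near.
Qed.
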